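(* Suppose there exists $C_F>0$ such that $\|F(D)\|<C_F$ for every $D\in\mathcal{D}$. Then for all $y,y'\in\mathbb{R}^m$ and every $x\in\mathbb{R}^d$, $$|\rho(x|y)-\rho(x|y')|\le 2\exp\left(\frac{\sigma(y,y')^2}{2\sigma^2}\right)\frac{\sigma(y,y')}{\sigma}\,\frac{\|y-y'\|}{\sigma}.$$ Furthermore, for every $r>0$ there exists $C(r)>0$ such that $$|\rho(x|y)-\rho(x|y')|\le C(r)\,\|y-y'\|$$ for every $x\in\mathbb{R}^d$ and every $y,y'\in\mathbb{R}^m$ with $\|y\|<r$ and $\|y'\|<r$.
   Context: Let $d,m$ be positive integers and $\sigma>0$ a real number. Let $\mathcal{D}$ be a (finite or infinite) family of bounded domains (connected open subsets) of $\mathbb{R}^d$, let $\mathcal{B}$ be a $\sigma$-field on $\mathcal{D}$, let $\mu_0$ be a probability measure on $(\mathcal{D},\mathcal{B})$ (the prior), and let $F:\mathcal{D}\to\mathbb{R}^m$ be a map measurable on $(\mathcal{D},\mathcal{B})$ (the forward operator). $\|\cdot\|$ is the standard Euclidean norm. For $D\in\mathcal{D}$ and $y\in\mathbb{R}^m$ define $$\Phi(D;y):=\exp\left(-\frac{1}{2\sigma^2}\|y-F(D)\|^2\right),\qquad Z(y):=\int_{\mathcal{D}}\Phi(D;y)\,\mu_0(dD),$$ and let $\mu^y$ (the posterior) be the probability measure on $\mathcal{D}$ given by $$\mu^y(dD):=\frac{1}{Z(y)}\Phi(D;y)\,\mu_0(dD).$$ For $y,y'\in\mathbb{R}^m$ define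 (this two-argument quantity is distinct from the constant $\sigma$) $$\sigma(y,y'):=\sup\left\{\max\{\|y-F(D)\|,\|y'-F(D)\|\}: D\in\mathcal{D}\right\}.$$ For $x\in\mathbb{R}^d$, the domain ratio of $x$ under $y$ is $$\rho(x|y):=\int_{\mathcal{D}}\chi_D(x)\,\mu^y(dD),$$ where $\chi_D(x)=1$ if $x\in D$ and $\chi_D(x)=0$ if $x\notin D$. It is understood that this integral is defined, i.e. that $D\mapsto\chi_D(x)$ is measurable on $(\mathcal{D},\mathcal{B})$ for each $x\in\mathbb{R}^d$. *)

(* Defs.v *)
From HB Require Import structures.
From mathcomp Require Import all_boot all_order all_algebra.
From mathcomp Require Import all_classical all_reals all_analysis.
From mathcomp Require Import measurable_realfun.

Set Implicit Arguments.
Unset Strict Implicit.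
Unset Printing Implicit Defensive.
Import Order.TTheory GRing.Theory Num.Theory.
Import numFieldNormedType.Exports.
Local Open Scope classical_set_scope.
Local Open Scope ring_scope.

(* The library norm on row vectors is the max norm, hence a separate
   Euclidean norm; both induce the same topology and bounded sets. *)
Definition enorm (R : realType) (n : nat) (v : 'rV[R]_n) : R :=
  Num.sqrt (\sum_(i < n) v ord0 i ^+ 2).

Definition borelRV (R : realType) (n : nat) :=
  g_sigma_algebraType (@open 'rV[R]_n).

HB.instance Definition _ (R : realType) (n : nat) :=
  Measurable.on (borelRV R n).

(* The ambient notion of domain is "connected open subset"; the empty set is
   not excluded. *)
Definition bounded_domain (R : realType) (d : nat) (D : set 'rV[R]_d) : Prop :=
  [/\ open D, connected D & bounded_set D].

(* T is the family of domains itself: its points stand for the members of the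
   family, its measurable sets for the sigma-field on the family. The map
   [dom] below sends a point to the subset of R^d it stands for. *)
Section posterior.
Context (R : realType) (m : nat) (disp : measure_display)
        (T : measurableType disp).
Variables (mu0 : probability T R) (s : R) (F : {mfun T >-> borelRV R m}).
Implicit Types (y : 'rV[R]_m) (D : T).

Definition misfit y D : R := enorm (y - (F D : 'rV[R]_m)).

Definition Phi D y : R := expR (- (1 / (2 * s ^+ 2)) * misfit y D ^+ 2).

Definition Z y : R := \int[mu0]_D Phi D y.

(* Meaningful when [F] is bounded, so that the set has a real supremum. *)
Definition sigma_sup y y' : R :=
  sup [set Num.max (misfit y D) (misfit y' D) | D in [set: T]].

Definition posterior y (A : set T) : \bar R :=
  ((Z y)^-1%:E * \int[mu0]_(D in A) (Phi D y)%:E)%E.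

Lemma measurable_coord (i : 'I_m) :
  measurable_fun setT (fun D : T => (F D : 'rV[R]_m) ord0 i).
Proof.
have h : measurable_fun setT (fun v : borelRV R m => (v : 'rV[R]_m) ord0 i).
  apply: (measurability _ (@RGenOInfty.measurableE R)).
  move=> _ [_ [a ->] <-]; rewrite setTI; apply: sub_sigma_algebra.
  have /continuousP := @coord_continuous R 1 m ord0 i.
  by apply; exact: interval_open.
exact: (measurableT_comp h (measurable_funPT F)).
Qed.

Lemma measurable_Phi y : measurable_fun setT (fun D => Phi D y).
Proof.
apply: (measurableT_comp (@measurable_expR R)).
apply: measurable_funM => //.
apply: measurable_funX.
apply: (measurableT_comp (f := @Num.sqrt R)); first 
  by apply: continuous_measurable_fun; exact: sqrt_continuous.
apply: measurable_sum => i; apply: measurable_funX.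
rewrite [X in measurable_fun _ X](_ : _ =
    (fun D => y ord0 i - (F D : 'rV[R]_m) ord0 i)); last first.
  by apply/funext => D; rewrite !mxE.
by apply: measurable_funB => //; exact: measurable_coord.
Qed.

Lemma Phi_gt0 y D : 0 < Phi D y. Proof. exact: expR_gt0. Qed.

Lemma Phi_le1 y D : Phi D y <= 1.
Proof.
rewrite -expR0 ler_expR mulNr oppr_le0 mulr_ge0 ?sqr_ge0//.
by rewrite div1r invr_ge0 mulr_ge0 ?sqr_ge0.
Qed.

Lemma Z_EFin y : (Z y)%:E = (\int[mu0]_D (Phi D y)%:E)%E.
Proof.
rewrite /Z /Rintegral fineK// ge0_fin_numE; last first.
  by apply: integral_ge0 => D _; rewrite lee_fin ltW// Phi_gt0.
apply: (@le_lt_trans _ _ (\int[mu0]_D (cst 1%:E D))%E).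
  apply: ge0_le_integral => //.
  - by move=> D _; rewrite lee_fin ltW// Phi_gt0.
  - by apply/measurable_EFinP; exact: measurable_Phi.
  - by move=> D _; rewrite lee_fin Phi_le1.
by rewrite integral_cst//= probability_setT mule1 ltry.
Qed.

Lemma Z_gt0 y : 0 < Z y.
Proof.
rewrite -lte_fin Z_EFin.
rewrite lt_neqAle eq_sym; apply/andP; split; last first.
  by apply: integral_ge0 => D _; rewrite lee_fin ltW// Phi_gt0.
apply/eqP => h.
have mP : measurable_fun setT (fun D => (Phi D y)%:E).
  by apply/measurable_EFinP; exact: measurable_Phi.
have : (\int[mu0]_D `|(Phi D y)%:E| = 0)%E.
  rewrite -[RHS]h; apply: eq_integral => D _.
  by rewrite gee0_abs// lee_fin ltW// Phi_gt0.
move/(ae_eq_integral_abs mu0 measurableT mP) => [N [mN N0 subN]].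
have NT : N = setT.
  apply/seteqP; split=> // D _; apply: subN => /= /(_ I)/eqP.
  by rewrite eqe gt_eqF// Phi_gt0.
by move: N0; rewrite NT /= probability_setT => /eqP; rewrite onee_eq0.
Qed.

Let posterior0 y : posterior y set0 = 0%E.
Proof. by rewrite /posterior integral_set0 mule0. Qed.

Let integral_Phi_ge0 y A : (0 <= \int[mu0]_(D in A) (Phi D y)%:E)%E.
Proof. by apply: integral_ge0 => D _; rewrite lee_fin ltW// Phi_gt0. Qed.

Let posterior_ge0 y A : (0 <= posterior y A)%E.
Proof. by rewrite /posterior mule_ge0// lee_fin invr_ge0 ltW// Z_gt0. Qed.

Let posterior_sigma_additive y : semi_sigma_additive (posterior y).
Proof.
move=> A mA tA mUA; rewrite /posterior.
have mP : measurable_fun setT (fun D => (Phi D y)%:E).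
  by apply/measurable_EFinP; exact: measurable_Phi.
rewrite [X in X @ _ --> _](_ : _ = (fun n => (Z y)^-1%:E *
    \sum_(0 <= i < n) \int[mu0]_(D in A i) (Phi D y)%:E)%E); last first.
  by apply/funext => n; rewrite ge0_sume_distrr.
apply: cvgeZl => //.
rewrite ge0_integral_bigcup//; last 2 first.
- exact: measurable_funTS.
- by move=> D _; rewrite lee_fin ltW// Phi_gt0.
by apply: is_cvg_ereal_nneg_natsum_cond => n _ _; exact: integral_Phi_ge0.
Qed.

HB.instance Definition _ y := isMeasure.Build _ _ _
  (posterior y) (posterior0 y) (posterior_ge0 y) (@posterior_sigma_additive y).

Let posterior_setT y : posterior y setT = 1%E.
Proof. by rewrite /posterior -Z_EFin -EFinM mulVf// gt_eqF// Z_gt0. Qed.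

HB.instance Definition _ y :=
  Measure_isProbability.Build _ _ _ (posterior y) (posterior_setT y).

Definition rho d (dom : T -> set 'rV[R]_d) (x : 'rV[R]_d) y : R :=
  \int[posterior y]_D \1_(dom D) x.

End posterior.

(* Main.v *)
Require Import Defs.
From HB Require Import structures.
From mathcomp Require Import all_boot all_order all_algebra.
From mathcomp Require Import all_classical all_reals all_analysis.
From mathcomp Require Import measurable_realfun ring lra.

Import Order.TTheory GRing.Theory Num.Theory.
Import numFieldNormedType.Exports.
Local Open Scope classical_set_scope.
Local Open Scope ring_scope.

(** Write [e] for the Euclidean distance between the two data [y] and [y'], and
let [M] bound every misfit |y - F(D)| and |y' - F(D)|.  The map t |-> exp(-t)
is 1-Lipschitz on [0, +oo[, and the difference of the two squared misfits at
[D] is the product of their sum, at most 2M, with their difference, at most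
[e] by the triangle inequality.  So the two likelihoods differ by at most
M e / s^2, uniformly in [D] ([ler_dist_Phi]), and so do their integrals over
any measurable set, the prior having mass one ([ler_dist_integral_Phi]).

The posterior mass of a measurable set [A] is the quotient of the integral over
[A] by the normalising constant.  Moving the numerator and moving the
denominator each cost M e / (s^2 Z(y)): for the denominator because the second
quotient is at most one ([ler_dist_ratio]).  Finally Z(y) is at least
exp(-M^2 / (2 s^2)), since the integrand is ([expR_le_Z]).  This gives
[posterior_lipschitz], an estimate in total variation: the bound is the same
for every [A].

The domain ratio at [x] is the posterior mass of the set of domains containing
[x] ([rho_posterior]), so both claims are instances of [posterior_lipschitz]:
M = sigma(y, y') gives the first, and M = r + C_F gives the second. *)

(** * The Euclidean norm *)

Section euclidean_norm.
Context {R : realType} {n : nat}.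
Implicit Types u v : 'rV[R]_n.

Lemma enorm_ge0 u : 0 <= enorm u.
Proof. exact: sqrtr_ge0. Qed.

Lemma sqr_enorm u : enorm u ^+ 2 = \sum_i u ord0 i ^+ 2.
Proof. by rewrite sqr_sqrtr// sumr_ge0// => i _; exact: sqr_ge0. Qed.

Lemma enorm0_eq0 u : enorm u = 0 -> u = 0.
Proof.
move=> u0; have /eqP := sqr_enorm u; rewrite u0 expr0n/= eq_sym.
rewrite psumr_eq0 => [/allP h|i _]; last exact: sqr_ge0.
apply/rowP => i; rewrite mxE; apply/eqP; rewrite -sqrf_eq0.
by apply: h; rewrite mem_index_enum.
Qed.

Lemma enormN u : enorm (- u) = enorm u.
Proof. by congr Num.sqrt; apply: eq_bigr => i _; rewrite mxE sqrrN. Qed.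

(** For nonzero [u] and [v], expand the squared Euclidean norm of
|v| u - |u| v, which is nonnegative. *)
Lemma enorm_CauchySchwarz u v :
  \sum_i u ord0 i * v ord0 i <= enorm u * enorm v.
Proof.
have [/enorm0_eq0 ->|u0] := eqVneq (enorm u) 0.
  by rewrite big1 ?mulr_ge0 ?enorm_ge0// => i _; rewrite mxE mul0r.
have [/enorm0_eq0 ->|v0] := eqVneq (enorm v) 0.
  by rewrite big1 ?mulr_ge0 ?enorm_ge0// => i _; rewrite mxE mulr0.
have uv_gt0 : 0 < enorm u * enorm v.
  by rewrite mulr_gt0// lt_def ?u0 ?v0 enorm_ge0.
have : 0 <= \sum_i (enorm v * u ord0 i - enorm u * v ord0 i) ^+ 2.
  by apply: sumr_ge0 => i _; exact: sqr_ge0.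
have -> : \sum_i (enorm v * u ord0 i - enorm u * v ord0 i) ^+ 2 =
    2 * (enorm u * enorm v) *
    (enorm u * enorm v - \sum_i u ord0 i * v ord0 i).
  rewrite (eq_bigr (fun i => enorm v ^+ 2 * u ord0 i ^+ 2 +
    enorm u ^+ 2 * v ord0 i ^+ 2 -
    2 * (enorm u * enorm v) * (u ord0 i * v ord0 i))); last first.
    by move=> i _; ring.
  rewrite sumrB big_split/= -!mulr_sumr -!sqr_enorm; ring.
rewrite pmulr_rge0; first by rewrite subr_ge0.
by rewrite mulr_gt0.
Qed.

Lemma ler_enormD u v : enorm (u + v) <= enorm u + enorm v.
Proof.
rewrite -(@ler_pXn2r _ 2)// ?nnegrE ?addr_ge0 ?enorm_ge0//.
rewrite sqr_enorm (eq_bigr (fun i =>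
  u ord0 i ^+ 2 + 2 * (u ord0 i * v ord0 i) + v ord0 i ^+ 2)); last first.
  by move=> i _; rewrite mxE; ring.
rewrite !big_split/= -mulr_sumr -!sqr_enorm.
have := enorm_CauchySchwarz u v; nra.
Qed.

Lemma ler_dist_enorm u v : `|enorm u - enorm v| <= enorm (u - v).
Proof.
have h u' v' : enorm u' - enorm v' <= enorm (u' - v').
  by rewrite lerBlDr; apply: le_trans (ler_enormD _ _); rewrite subrK.
by rewrite ler_norml h andbT lerNl opprB -(opprB v u) enormN h.
Qed.

End euclidean_norm.

(** * Two inequalities between real numbers *)

Section real_inequalities.
Context {R : realType}.
Implicit Types u v : R.

(** For u <= v, factor out exp(-u), which is at most 1, and use
1 - exp(u - v) <= v - u. *)
Lemma expRN_lipschitz u v : 0 <= u -> 0 <= v ->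
  `|expR (- u) - expR (- v)| <= `|u - v|.
Proof.
wlog uv : u v / u <= v => [h u0 v0|u0 _].
  have [uv|/ltW vu] := leP u v; first exact: h.
  by rewrite distrC (distrC u); exact: h.
have e1 : expR (- u) <= 1 by rewrite -expR0 ler_expR oppr_le0.
have e0 := expR_gt0 (- u).
have h := expR_ge1Dx (u - v).
have -> : expR (- v) = expR (- u) * expR (u - v).
  by rewrite -expRD; congr expR; ring.
have h1 : expR (u - v) <= 1 by rewrite -expR0 ler_expR subr_le0.
rewrite ger0_norm; last by rewrite subr_ge0 ler_piMr// ltW.
rewrite ler0_norm ?subr_le0//; nra.
Qed.

(** The difference of the quotients is ((a - a') - (a' / z') (z - z')) / z, and
a' / z' lies between 0 and 1.  Only [z] remains in the denominator, so a lower
bound on one of the two normalising constants suffices later on. *)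
Lemma ler_dist_ratio (a z a' z' e : R) : 0 < z -> 0 < z' -> 0 <= a' <= z' ->
  `|a - a'| <= e -> `|z - z'| <= e -> `|a / z - a' / z'| <= 2 * e / z.
Proof.
move=> z0 z'0 /andP[a'0 a'z'] ha hz.
have -> : a / z - a' / z' = ((a - a') - a' / z' * (z - z')) / z.
  by field; rewrite !gt_eqF.
rewrite normrM [`|z^-1|]gtr0_norm ?invr_gt0// ler_pM2r ?invr_gt0//.
rewrite (le_trans (ler_normB _ _))// mulr_natl mulr2n lerD// normrM.
rewrite ger0_norm ?divr_ge0 ?(ltW z'0)//.
rewrite (le_trans _ hz)// ler_piMl//.
by rewrite ler_pdivrMr// mul1r.
Qed.

End real_inequalities.

(** * Stability of the posterior in the data *)

Section posterior_stability.
Context {R : realType} {m : nat} {disp : measure_display}.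
Context {T : measurableType disp}.
Variables (mu0 : probability T R) (s : R) (F : {mfun T >-> borelRV R m}).
Hypothesis s_gt0 : 0 < s.
Implicit Types (y : 'rV[R]_m) (A : set T).

Lemma ler_dist_misfit y y' D :
  `|misfit F y D - misfit F y' D| <= enorm (y - y').
Proof.
apply: le_trans (ler_dist_enorm _ _) _.
by rewrite opprB addrA subrK.
Qed.

Lemma integrable_Phi y A : measurable A ->
  mu0.-integrable A (EFin \o (fun D => Phi s F D y)).
Proof.
move=> mA; apply: measurable_bounded_integrable => //.
- by rewrite (le_lt_trans (probability_le1 mu0 mA))// ltry.
- by apply: measurable_funTS; exact: measurable_Phi.
- exists 1; split=> // M M1 D _ /=.
  rewrite ger0_norm ?(ltW (Phi_gt0 _ _ _ _))//.
  by rewrite (le_trans (Phi_le1 _ _ _ _)) ?ltW.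
Qed.

Lemma integral_Phi_fin_num y A : measurable A ->
  (\int[mu0]_(D in A) (Phi s F D y)%:E)%E \is a fin_num.
Proof. by move=> mA; have := integrable_fin_num mA (integrable_Phi y _ mA). Qed.

Lemma fine_posterior y A : measurable A ->
  fine (posterior mu0 s F y A) =
  (\int[mu0]_(D in A) Phi s F D y) / Z mu0 s F y.
Proof.
move=> mA; rewrite /posterior fineM//; first by rewrite mulrC.
exact: integral_Phi_fin_num.
Qed.

Lemma rho_posterior d (dom : T -> set 'rV[R]_d) x y :
  measurable [set D | dom D x] ->
  rho mu0 s F dom x y = fine (posterior mu0 s F y [set D | dom D x]).
Proof.
move=> mX; rewrite /rho /Rintegral; congr fine.
by rewrite -[in RHS](setIT [set D | dom D x]) -integral_indic.
Qed.

(** [M] is kept arbitrary because the two claims need different bounds: the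
supremum of the misfits, and a bound uniform over all data in a ball. *)
Section misfit_bound.
Variables (y y' : 'rV[R]_m) (M : R).
Hypothesis yM : forall D, misfit F y D <= M.
Hypothesis y'M : forall D, misfit F y' D <= M.

Lemma ler_dist_Phi D :
  `|Phi s F D y - Phi s F D y'| <= M * enorm (y - y') / s ^+ 2.
Proof.
rewrite /Phi; set k := 1 / _.
have k0 : 0 <= k by rewrite divr_ge0// mulr_ge0// sqr_ge0.
have kmis0 z : 0 <= k * misfit F z D ^+ 2 by rewrite mulr_ge0// sqr_ge0.
rewrite !mulNr (le_trans (expRN_lipschitz _ _ _ _))//.
rewrite -mulrBr normrM ger0_norm// subr_sqr normrM.
have a0 : 0 <= misfit F y D + misfit F y' D by rewrite addr_ge0// enorm_ge0.
rewrite (ger0_norm a0).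
have -> : M * enorm (y - y') / s ^+ 2 =
    k * (enorm (y - y') * (M + M)).
  by rewrite /k; field; rewrite gt_eqF.
by rewrite ler_wpM2l// ler_pM// ?ler_dist_misfit// lerD.
Qed.

Lemma ler_dist_integral_Phi A : measurable A ->
  `|(\int[mu0]_(D in A) Phi s F D y) - (\int[mu0]_(D in A) Phi s F D y')| <=
  M * enorm (y - y') / s ^+ 2.
Proof.
move=> mA; set c := M * _ / _.
have iB := integrableB mA (integrable_Phi y _ mA) (integrable_Phi y' _ mA).
have c0 : 0 <= c by exact: le_trans (normr_ge0 _) (ler_dist_Phi point).
rewrite -RintegralB//; try exact: integrable_Phi.
apply: le_trans (le_normr_Rintegral mA iB) _.
apply: (@le_trans _ _ (\int[mu0]_(_ in A) c)).
  apply: le_Rintegral => //; first exact: integrable_norm iB.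
    exact: finite_measure_integrable_cst.
  by move=> D _; exact: ler_dist_Phi.
rewrite Rintegral_cst// ler_piMr//.
by rewrite -lee_fin fineK ?fin_num_measure// probability_le1.
Qed.

Lemma expR_le_Z : expR (- (M ^+ 2 / (2 * s ^+ 2))) <= Z mu0 s F y.
Proof.
set c := expR _.
have -> : c = \int[mu0]_(_ in [set: T]) c.
  by rewrite Rintegral_cst//= probability_setT mulr1.
apply: le_Rintegral => //; last 1 first.
- move=> D _; rewrite ler_expR mulNr lerN2 mul1r mulrC.
  rewrite ler_wpM2r ?invr_ge0 ?mulr_ge0 ?(ltW s_gt0)//.
  by rewrite ler_sqr ?nnegrE ?enorm_ge0// (le_trans _ (yM D)) ?enorm_ge0.
- exact: finite_measure_integrable_cst.
- exact: integrable_Phi.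
Qed.

(** The right-hand side does not mention [A]: the posteriors are close in total
variation.  The factor 2 accounts for the changes of the numerator and of the
normalising constant, the exponential for the lower bound on the latter. *)
Lemma posterior_lipschitz A : measurable A ->
  `|fine (posterior mu0 s F y A) - fine (posterior mu0 s F y' A)| <=
  2 * expR (M ^+ 2 / (2 * s ^+ 2)) * (M / s) * (enorm (y - y') / s).
Proof.
move=> mA.
have -> : fine (posterior mu0 s F y A) - fine (posterior mu0 s F y' A) =
    (\int[mu0]_(D in A) Phi s F D y) / Z mu0 s F y -
    (\int[mu0]_(D in A) Phi s F D y') / Z mu0 s F y'.
  by congr (_ - _); exact: fine_posterior.
have Z0 := Z_gt0 mu0 s F y; have Z'0 := Z_gt0 mu0 s F y'.
have AZ : 0 <= \int[mu0]_(D in A) Phi s F D y' <= Z mu0 s F y'.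
  rewrite Rintegral_ge0 => [|D _]; last by rewrite ltW// Phi_gt0.
  rewrite -lee_fin Z_EFin /Rintegral fineK; last exact: integral_Phi_fin_num.
  apply: ge0_subset_integral => //.
  - by apply/measurable_EFinP; exact: measurable_Phi.
  - by move=> D _; rewrite lee_fin ltW// Phi_gt0.
have dA := ler_dist_integral_Phi _ mA.
have dZ := ler_dist_integral_Phi _ measurableT.
apply: le_trans (ler_dist_ratio _ _ _ _ _ Z0 Z'0 AZ dA dZ) _.
have M0 : 0 <= M by exact: le_trans (enorm_ge0 _) (yM point).
rewrite [leRHS](_ : _ = 2 * (M * enorm (y - y') / s ^+ 2) *
    expR (M ^+ 2 / (2 * s ^+ 2))); last by field; rewrite gt_eqF.
rewrite ler_wpM2l ?mulr_ge0 ?invr_ge0 ?exprn_ge0 ?enorm_ge0 ?(ltW s_gt0)//.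
have ZV : (Z mu0 s F y)^-1 <= (expR (- (M ^+ 2 / (2 * s ^+ 2))))^-1.
  rewrite lef_pV2; first exact: expR_le_Z.
  - rewrite posrE; exact: Z0.
  - by rewrite posrE expR_gt0.
by apply: le_trans ZV _; rewrite expRN invrK.
Qed.

End misfit_bound.

End posterior_stability.

Theorem theorem3p2 (R : realType) (d m : nat) (d_gt0 : (0 < d)%N)
    (m_gt0 : (0 < m)%N) (s : R) (s_gt0 : 0 < s)
    (disp : measure_display) (T : measurableType disp)
    (dom : T -> set 'rV[R]_d) (dom_inj : injective dom)
    (dom_domain : forall D : T, bounded_domain (dom D))
    (mu0 : probability T R) (F : {mfun T >-> borelRV R m})
    (chi_measurable : forall x : 'rV[R]_d,
       measurable_fun [set: T] (fun D : T => \1_(dom D) x : R))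
    (F_bounded : exists CF : R, 0 < CF /\
       forall D : T, enorm (F D : 'rV[R]_m) < CF) :
  (forall (y y' : 'rV[R]_m) (x : 'rV[R]_d),
     `|rho mu0 s F dom x y - rho mu0 s F dom x y'| <=
       2 * expR (sigma_sup F y y' ^+ 2 / (2 * s ^+ 2)) *
       (sigma_sup F y y' / s) * (enorm (y - y') / s)) /\
  (forall r : R, 0 < r -> exists C : R, 0 < C /\
     forall (x : 'rV[R]_d) (y y' : 'rV[R]_m), enorm y < r -> enorm y' < r ->
       `|rho mu0 s F dom x y - rho mu0 s F dom x y'| <= C * enorm (y - y')).
Proof.
have mX x : measurable [set D | dom D x].
  (* The domains containing [x] are those at which the indicator equals 1. *)
  rewrite (_ : [set D | _] =
      [set: T] `&` (fun D => \1_(dom D) x : R) @^-1` [set 1]).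
    exact: chi_measurable.
  rewrite setTI; apply/seteqP; split=> D /=; rewrite indicE.
    by move=> xD; rewrite mem_set.
  case: (boolP (x \in dom D)) => [/set_mem//|_ /eqP].
  by rewrite eq_sym oner_eq0.
have [CF [CF0 FC]] := F_bounded.
have misfitC y D : misfit F y D <= enorm y + CF.
  rewrite (le_trans (ler_enormD _ _))// lerD2l enormN; exact/ltW.
have rhoB x y y' : rho mu0 s F dom x y - rho mu0 s F dom x y' =
    fine (posterior mu0 s F y [set D | dom D x]) -
    fine (posterior mu0 s F y' [set D | dom D x]).
  by congr (_ - _); exact: rho_posterior.
split=> [y y' x|r r0].
  have supE D : Num.max (misfit F y D) (misfit F y' D) <= sigma_sup F y y'.
    apply: ub_le_sup; last by exists D.
    exists (Num.max (enorm y) (enorm y') + CF) => _ [D' _ <-].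
    by rewrite ge_max !(le_trans (misfitC _ _))// lerD2r le_max lexx ?orbT.
  rewrite rhoB; apply: posterior_lipschitz => // D;
    by rewrite (le_trans _ (supE D))// le_max lexx ?orbT.
(* Data in the ball of radius [r] have all their misfits bounded by r + CF. *)
exists (2 * expR ((r + CF) ^+ 2 / (2 * s ^+ 2)) * ((r + CF) / s) / s).
split=> [|x y y' yr y'r].
  by rewrite !(mulr_gt0, invr_gt0, expR_gt0, addr_gt0).
rewrite rhoB.
rewrite (le_trans (posterior_lipschitz mu0 s F s_gt0 y y' (r + CF) _ _ _ _))//.
- by move=> D; rewrite (le_trans (misfitC _ _))// lerD2r ltW.
- by move=> D; rewrite (le_trans (misfitC _ _))// lerD2r ltW.
- by rewrite le_eqVlt; apply/orP; left; apply/eqP; ring.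
Qed.
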